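(* Assume $\mathsf{MA}_{\aleph_1}$. If $A\subseteq\mathbb R$ is good and $\aleph_1$-dense, then there is no forcing notion of size $\aleph_1$ which does not collapse $\aleph_1$ and which forces $A$ to be order isomorphic to its reverse ordering $A^*=\{-r:r\in A\}$.
   Context: A set $A\subseteq\mathbb R$ is $\aleph_1$-dense if between any two of its points there are exactly $\aleph_1$ many points of $A$. For $a\in[\omega_1]^n$ write $a(i)$ for the $i$-th element of $a$ in increasing order. An $\aleph_1$-dense $A\subseteq\mathbb R$ is good if there is an injective enumeration $A=\{r_\xi:\xi<\omega_1\}$ such that for every $n<\omega$ and every sequence $\langle a_\alpha:\alpha<\omega_1\rangle$ with $a_\alpha\in[\omega_1]^n$, there exist $\alpha<\beta$ with $r_{a_\alpha(i)}\le r_{a_\beta(i)}$ for every $i<n$. *)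

(* Defs.v *)
From mathcomp Require Import all_boot all_order all_algebra.
From mathcomp Require Import boolp wochoice classical_sets functions cardinality.
From mathcomp Require Import reals.

Set Implicit Arguments.
Unset Strict Implicit.
Unset Printing Implicit Defensive.

Import Order.TTheory GRing.Theory Num.Theory.
Local Open Scope classical_set_scope.
Local Open Scope ring_scope.

(* Fix a well-order of the uncountable type [set nat]; its elements with
   countably many predecessors form a well-order of type omega_1, as the
   lemmas below confirm. *)
Definition wo_le : rel (set nat) := sval (well_ordering_principle (set nat)).
Definition wo_lt (x y : set nat) : Prop := wo_le x y /\ x <> y.

Definition omega1 : Type := {x : set nat | countable [set y | wo_lt y x]}.
Definition lt1 (x y : omega1) : Prop := wo_lt (sval x) (sval y).

Lemma wo_leP : well_order wo_le.
Proof. exact: (svalP (well_ordering_principle (set nat))). Qed.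

Lemma wo_min (D : set (set nat)) :
  D !=set0 -> exists2 m, D m & forall x, D x -> wo_le m x.
Proof.
case=> x Dx; have [|m [[Dm mD] _]] := @wo_leP (fun x => `[< D x >]).
  by exists x; apply/asboolP.
exists m; first by move/asboolP: Dm.
by move=> y Dy; apply: mD; apply/asboolP.
Qed.

Lemma wo_le_anti x y : wo_le x y -> wo_le y x -> x = y.
Proof.
move=> xy yx; pose D : pred (set nat) := fun z => `[< z = x \/ z = y >].
have refl z : wo_le z z.
  by have [|m -> /(_ z erefl)] := @wo_min [set z]; first by exists z.
have Dx : x \in D by apply/asboolP; left.
have Dy : y \in D by apply/asboolP; right.
have [|m [_ mU]] := @wo_leP D; first by exists x.
rewrite -(mU x); last by split=> // z /asboolP[] ->.
by rewrite -(mU y)//; split=> // z /asboolP[] ->.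
Qed.

Lemma wo_lt_total x y : [\/ wo_lt x y, x = y | wo_lt y x].
Proof.
have [->|xy] := pselect (x = y); first by constructor 2.
have [|m [] -> mP] := @wo_min [set x; y]; first by exists x; left.
- by constructor 1; split=> //; apply: mP; right.
- by constructor 3; split; [apply: mP; left | exact/nesym].
Qed.

Lemma wo_lt_not_le x y : wo_lt x y -> ~ wo_le y x.
Proof. by move=> [xy nxy] yx; apply: nxy; apply: wo_le_anti. Qed.

Lemma wo_lt_trans x y z : wo_lt x y -> wo_lt y z -> wo_lt x z.
Proof.
move=> xy yz; have [|m] := @wo_min [set x; y; z].
  by exists x; left; left.
case=> [[]|] -> mP.
- case: (wo_lt_total x z) => // [xz|zx].
    by subst z; case: (wo_lt_not_le xy); case: yz.
  by case: (wo_lt_not_le zx); apply: mP; right.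
- by case: (wo_lt_not_le xy); apply: mP; left; left.
- by case: (wo_lt_not_le yz); apply: mP; left; right.
Qed.

Lemma wo_lt_wf : well_founded wo_lt.
Proof.
move=> x; apply: contrapT => nx.
have [|m nm mP] := @wo_min [set z | ~ Acc wo_lt z]; first by exists x.
apply: nm; constructor=> y ym; apply: contrapT => ny.
exact: (wo_lt_not_le ym) (mP y ny).
Qed.

Lemma lt1_trans x y z : lt1 x y -> lt1 y z -> lt1 x z.
Proof. exact: wo_lt_trans. Qed.

Lemma lt1_irrefl x : ~ lt1 x x.
Proof. by case. Qed.

Lemma lt1_total x y : [\/ lt1 x y, x = y | lt1 y x].
Proof.
case: (wo_lt_total (sval x) (sval y)) => xy; [by constructor 1| |by constructor 3].
by constructor 2; exact: val_inj.
Qed.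

Lemma lt1_wf : well_founded lt1.
Proof.
move=> x; move: {2}(sval x) (erefl (sval x)) => u.
elim/(well_founded_ind wo_lt_wf): u x => u IH x xu.
by constructor=> y yx; apply: (IH (sval y)) => //; rewrite -xu.
Qed.

Lemma countable_lt1 x : countable [set y | lt1 y x].
Proof.
case/countable_injP: (svalP x) => f fi; apply/countable_injP.
exists (f \o sval) => y z; rewrite !inE => yx zx /= /fi yz.
by apply: val_inj; apply: yz; rewrite inE.
Qed.

Lemma uncountable_omega1 : ~ countable [set: omega1].
Proof.
case/countable_injP=> f fi.
have cC : countable [set x | countable [set y | wo_lt y x]].
  apply/countable_injP.
  exists (fun x => if pselect (countable [set y | wo_lt y x]) is left c
                   then f (exist _ x c) else 0%N) => x y.
  rewrite !inE /=; case: pselect => // cx; case: pselect => // cy _ _.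
  by move/fi; rewrite !inE => /(_ I I) [].
have [m nm mP] :
    exists2 m, ~ countable [set y | wo_lt y m]
             & forall x, ~ countable [set y | wo_lt y x] -> wo_le m x.
  apply: (@wo_min [set x | ~ countable [set y | wo_lt y x]]).
  apply: contrapT => nD.
  have : countable [set: set nat].
    suff -> : [set: set nat] = [set x | countable [set y | wo_lt y x]] by [].
    apply/seteqP; split=> // x _ /=; apply: contrapT => cx.
    by apply: nD; exists x.
  case/countable_injP=> g gi.
  pose D := [set n | exists X : set nat, g X = n /\ ~ X n].
  have [Dg|nDg] := pselect (D (g D)).
    case: (Dg) => X [/gi]; rewrite !inE => /(_ I I) ->; exact.
  by apply: (nDg); exists D.
apply: nm; apply: sub_countable cC; apply: subset_card_le => y ym /=.
by apply: contrapT => /mP; apply: wo_lt_not_le.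
Qed.

Definition card_aleph1 (T : Type) (S : set T) : Prop := (S #= [set: omega1])%card.

Definition aleph1_dense (R : realType) (A : set R) : Prop :=
  forall a b, A a -> A b -> a < b -> card_aleph1 (A `&` [set x | a < x < b]).

(* An element [a] of [omega_1]^n is given by its increasing enumeration
   [a 0 < ... < a (n-1)]. *)
Definition increasing1 n (a : 'I_n -> omega1) : Prop :=
  forall i j : 'I_n, (i < j)%N -> lt1 (a i) (a j).

Definition good (R : realType) (A : set R) : Prop :=
  exists r : omega1 -> R,
    [/\ injective r, range r = A &
        forall (n : nat) (a : omega1 -> 'I_n -> omega1),
          (forall alpha, increasing1 (a alpha)) ->
          exists alpha beta, lt1 alpha beta /\
            forall i : 'I_n, r (a alpha i) <= r (a beta i)].

Record forcing_notion := ForcingNotion {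
  cond :> Type;
  fle : cond -> cond -> Prop;
  fle_refl : forall p, fle p p;
  fle_trans : forall p q r, fle p q -> fle q r -> fle p r;
  cond_inhabited : inhabited cond }.

Definition compatible (P : forcing_notion) (p q : P) : Prop :=
  exists r, fle r p /\ fle r q.

Definition antichain (P : forcing_notion) (S : set P) : Prop :=
  forall p q, S p -> S q -> p <> q -> ~ compatible p q.

Definition ccc (P : forcing_notion) : Prop :=
  forall S : set P, antichain S -> countable S.

Definition dense_set (P : forcing_notion) (D : set P) : Prop :=
  forall p, exists q, fle q p /\ D q.

Definition forcing_filter (P : forcing_notion) (G : set P) : Prop :=
  [/\ G !=set0,
      forall p q, G p -> fle p q -> G q &
      forall p q, G p -> G q -> exists r, [/\ G r, fle r p & fle r q]].

Definition MA_aleph1 : Prop :=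
  forall P : forcing_notion, ccc P ->
  forall D : omega1 -> set P, (forall xi, dense_set (D xi)) ->
  exists G : set P,
    forcing_filter G /\ forall xi, (G `&` D xi) !=set0.

(* The set [VSet I x] is {x i : i in I}. *)
Inductive vset : Type := VSet (I : Type) (x : I -> vset).

Definition vempty : vset := VSet (fun i : False => match i with end).

Definition vsucc (x : vset) : vset :=
  let: VSet T f := x in
  VSet (fun o : option T => if o is Some i then f i else x).

Definition vnat (n : nat) : vset := iter n vsucc vempty.

Definition vord : omega1 -> vset :=
  Fix lt1_wf (fun _ => vset) (fun x rec =>
    VSet (fun y : {y | lt1 y x} => rec (sval y) (svalP y))).

Definition vomega1 : vset := VSet vord.

(* A real is its lower Dedekind cut, where a rational [q] is represented by
   the natural number [pickle q]; the order of the reals is then strict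
   inclusion. *)
Definition vreal (R : realType) (x : R) : vset :=
  VSet (fun q : {q : rat | ratr q < x} => vnat (pickle (sval q))).

Definition vreals (R : realType) (A : set R) : vset :=
  VSet (fun x : {x : R | A x} => vreal (sval x)).

(* Formulas of the language of set theory with parameters in [N], in
   higher-order abstract syntax. *)
Inductive formula (N : Type) : Type :=
| fMem (x y : N)
| fEq (x y : N)
| fAnd (phi psi : formula N)
| fNot (phi : formula N)
| fEx (phi : N -> formula N).

Section Formulas.
Variable N : Type.
Implicit Types (phi psi : formula N) (x y z u v w f k A B X Y : N).

Definition fOr phi psi := fNot (fAnd (fNot phi) (fNot psi)).
Definition fImp phi psi := fNot (fAnd phi (fNot psi)).
Definition fIff phi psi := fAnd (fImp phi psi) (fImp psi phi).
Definition fAll (phi : N -> formula N) := fNot (fEx (fun x => fNot (phi x))).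
Definition fAllIn X (phi : N -> formula N) :=
  fAll (fun x => fImp (fMem x X) (phi x)).
Definition fExIn X (phi : N -> formula N) :=
  fEx (fun x => fAnd (fMem x X) (phi x)).

(* z = {x, y} *)
Definition fUPair z x y :=
  fAll (fun w => fIff (fMem w z) (fOr (fEq w x) (fEq w y))).

(* z = (x, y) = {{x, x}, {x, y}} *)
Definition fOPair z x y :=
  fEx (fun u => fEx (fun v =>
    fAnd (fUPair u x x) (fAnd (fUPair v x y) (fUPair z u v)))).

(* (x, y) \in f *)
Definition fApp f x y := fEx (fun z => fAnd (fOPair z x y) (fMem z f)).

Definition fFun f X Y :=
  fAnd (fAllIn f (fun z => fExIn X (fun x => fExIn Y (fun y => fOPair z x y))))
       (fAllIn X (fun x => fExIn Y (fun y =>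
          fAnd (fApp f x y) (fAll (fun y' => fImp (fApp f x y') (fEq y' y)))))).

Definition fInjective f :=
  fAll (fun x => fAll (fun x' => fAll (fun y =>
    fImp (fAnd (fApp f x y) (fApp f x' y)) (fEq x x')))).

Definition fOnto f X Y := fAllIn Y (fun y => fExIn X (fun x => fApp f x y)).

(* the strict order of the reals, viewed as Dedekind cuts *)
Definition fCutLt x y :=
  fAnd (fAllIn x (fun z => fMem z y)) (fNot (fEq x y)).

Definition fOrderIsomorphic A B :=
  fEx (fun f =>
    fAnd (fAnd (fFun f A B) (fAnd (fInjective f) (fOnto f A B)))
      (fAllIn A (fun x => fAllIn A (fun x' => fAllIn B (fun y =>
        fAllIn B (fun y' =>
          fImp (fAnd (fApp f x y) (fApp f x' y'))
               (fIff (fCutLt x x') (fCutLt y y')))))))).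

(* For an ordinal k: some smaller ordinal is mapped onto k, i.e. k is not a
   cardinal. *)
Definition fCollapsed k :=
  fExIn k (fun b => fEx (fun f => fAnd (fFun f b k) (fOnto f b k))).

End Formulas.

Section Forcing.
Variable P : forcing_notion.

(* The name [Name I tau c] is {(tau i, c i) : i in I}. *)
Inductive name : Type := Name (I : Type) (tau : I -> name) (c : I -> P).

(* No largest condition is assumed: the name of x is {(check y, p) : y in x,
   p in P}. *)
Fixpoint check (x : vset) : name :=
  let: VSet T f := x in
  Name (fun ip : T * P => check (f ip.1)) (fun ip : T * P => ip.2).

Definition dense_below (D : set P) (p : P) : Prop :=
  forall r, fle r p -> exists q, fle q r /\ D q.

(* The forcing relation as defined in the ground model (Kunen, Set Theory,
   1980, Definition VII.3.3). *)
Fixpoint forces_eq (p : P) (s t : name) {struct s} : Prop :=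
  let: Name T s' c := s in
  let: Name U t' d := t in
  (forall i, dense_below
     [set q | fle q (c i) -> exists j, fle q (d j) /\ forces_eq q (s' i) (t' j)]
     p) /\
  (forall j, dense_below
     [set q | fle q (d j) -> exists i, fle q (c i) /\ forces_eq q (s' i) (t' j)]
     p).

Definition forces_mem (p : P) (s t : name) : Prop :=
  let: Name U t' d := t in
  dense_below [set q | exists j, fle q (d j) /\ forces_eq q (t' j) s] p.

Fixpoint forces (p : P) (phi : formula name) {struct phi} : Prop :=
  match phi with
  | fMem s t => forces_mem p s t
  | fEq s t => forces_eq p s t
  | fAnd phi psi => forces p phi /\ forces p psi
  | fNot phi => forall q, fle q p -> ~ forces q phi
  | fEx phi => dense_below [set q | exists s, forces q (phi s)] p
  end.

Definition forced (phi : formula name) : Prop := forall p, forces p phi.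

End Forcing.

Definition not_collapse_aleph1 (P : forcing_notion) : Prop :=
  forced (fNot (fCollapsed (check P vomega1))).

Definition forces_isomorphic_to_reverse
    (P : forcing_notion) (R : realType) (A : set R) : Prop :=
  forced (fOrderIsomorphic (check P (vreals A))
                           (check P (vreals [set - r | r in A]))).

(* Main.v *)
From HB Require Import structures.
Require Import Defs.
From mathcomp Require Import all_boot all_order all_algebra.
From mathcomp Require Import boolp classical_sets functions cardinality reals.

Set Implicit Arguments.
Unset Strict Implicit.
Unset Printing Implicit Defensive.

Import Order.TTheory GRing.Theory Num.Theory.
Local Open Scope classical_set_scope.

(* Let P, of size aleph_1, add a decreasing map g from A to A without
   collapsing omega_1.  No condition can force g to map the complement of a
   countable U into U, so below every condition a pair g(x) = y with x and y
   outside U is decided.  As |P| = aleph_1, a recursion of length omega_1 in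
   the ground model yields countably many sequences of pairwise disjoint pairs
   such that every condition has extensions deciding that unboundedly many of
   these pairs belong to g.  Goodness makes the poset of finite partial
   colourings of such a sequence, with increasing colour classes, ccc, so by MA
   the sequence is a union of countably many strictly increasing maps.  The
   decreasing g meets each of them in at most one pair, so in the extension an
   unbounded subset of omega_1 is countable: omega_1 is collapsed. *)

(** * The forcing relation *)

Section ForcingTheory.
Variable P : forcing_notion.
Implicit Types (p q : P) (D : set P) (s t u v w x y z f X : name P).

Lemma dense_below_mono D p q : fle q p -> dense_below D p -> dense_below D q.
Proof. by move=> qp Dp r rq; apply: Dp; apply: fle_trans qp. Qed.

Lemma dense_below_bind D D' p :
  dense_below D p -> (forall q, fle q p -> D q -> dense_below D' q) ->
  dense_below D' p.
Proof.
move=> Dp DD r rp; have [q [qr Dq]] := Dp r rp.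
have [q' [q'q D'q']] := DD q (fle_trans qr rp) Dq q (fle_refl q).
by exists q'; split=> //; apply: fle_trans qr.
Qed.

Lemma dense_below_point D p : (forall q, fle q p -> D q) -> dense_below D p.
Proof. by move=> DP r rp; exists r; split; [exact: fle_refl | exact: DP]. Qed.

Lemma forces_eq_mono p q s t : fle q p -> forces_eq p s t -> forces_eq q s t.
Proof.
case: s => I s c; case: t => J t d qp /= [h1 h2].
by split=> i; apply: dense_below_mono qp _.
Qed.

Lemma forces_mem_mono p q s t : fle q p -> forces_mem p s t -> forces_mem q s t.
Proof. by case: t => J t d; apply: dense_below_mono. Qed.

Lemma forces_mono (phi : formula (name P)) p q :
  fle q p -> forces p phi -> forces q phi.
Proof.
elim: phi p q => [x y|x y|a IHa b IHb|a IHa|a IHa] p q qp /=.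
- exact: forces_mem_mono.
- exact: forces_eq_mono.
- by case=> pa pb; split; [exact: IHa qp _ | exact: IHb qp _].
- by move=> pa r rq; apply: pa; apply: fle_trans qp.
- exact: dense_below_mono.
Qed.

(** Membership, equality and existence are stated through [dense_below], which is idempotent;
    conjunction goes by induction, and negation needs monotonicity only. This is what gives the
    connectives defined by negation their classical meaning. *)
Lemma forces_dense (phi : formula (name P)) p :
  dense_below [set q | forces q phi] p -> forces p phi.
Proof.
elim: phi p => [x y|x y|a IHa b IHb|a IHa|a IHa] p /=.
- by case: y => J y d /dense_below_bind; apply=> q.
- case: x => I x c; case: y => J y d pxy.
  by split=> i; apply: dense_below_bind pxy _ => q _ [].
- move=> pab; split; [apply: IHa|apply: IHb];
  by apply: dense_below_bind pab _ => q _ [qa qb]; apply: dense_below_point => r rq;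
    apply: forces_mono rq _.
- move=> pa q qp qa; have [r [rq /(_ r (fle_refl r))]] := pa q qp.
  by apply; apply: forces_mono rq _.
- by move/dense_below_bind; apply=> q.
Qed.

Lemma forces_bind D (phi : formula (name P)) p :
  dense_below D p -> (forall q, fle q p -> D q -> forces q phi) -> forces p phi.
Proof.
move=> Dp DD; apply: forces_dense; apply: dense_below_bind Dp _ => q qp Dq.
by apply: dense_below_point => r rq; apply: forces_mono rq _; apply: DD.
Qed.

Lemma forces_imp p (a b : formula (name P)) :
  forces p (fImp a b) <-> forall q, fle q p -> forces q a -> forces q b.
Proof.
split=> [/= pab q qp qa|pab q qp /= [qa qnb]].
  apply: forces_dense => r rq; apply: contrapT => nr.
  apply: (pab r); first exact: fle_trans qp.
  split; first exact: forces_mono rq _.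
  by move=> r' r'r r'b; apply: nr; exists r'.
by apply: (qnb q); [exact: fle_refl | exact: pab].
Qed.

Lemma forces_all p (phi : name P -> formula (name P)) :
  forces p (fAll phi) <-> forall s, forces p (phi s).
Proof.
split=> [/= pphi s|pphi q qp /= /(_ q (fle_refl q)) [r [rq [s]]]].
  apply: forces_dense => r rp; apply: contrapT => nr; apply: (pphi r rp).
  move=> r' r'r; exists r'; split; first exact: fle_refl.
  exists s => r'' r''r' h; apply: nr; exists r''; split=> //.
  exact: fle_trans r'r.
move/(_ r (fle_refl r)); apply; apply: forces_mono (pphi s).
exact: fle_trans qp.
Qed.

Lemma forces_or p (a b : formula (name P)) :
  forces p (fOr a b) <-> dense_below [set q | forces q a \/ forces q b] p.
Proof.
split=> [/= pab q qp|pab q qp /= [qa qb]].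
  apply: contrapT => nq; apply: (pab q qp).
  by split=> r rq h; apply: nq; exists r; split=> //; [left|right].
have [r [rq]] := pab q qp.
by case; [apply: qa | apply: qb].
Qed.

Lemma forces_iff p (a b : formula (name P)) :
  forces p (fIff a b) <-> forall q, fle q p -> forces q a <-> forces q b.
Proof.
split=> [[/forces_imp h1 /forces_imp h2] q qp|h]; first by split; [exact: h1|exact: h2].
by split; apply/forces_imp => q /h; case.
Qed.

Lemma forces_allIn p X (phi : name P -> formula (name P)) :
  forces p (fAllIn X phi) <->
  forall s q, fle q p -> forces_mem q s X -> forces q (phi s).
Proof.
split=> [/forces_all h s|h]; first by move/forces_imp: (h s) => hs q; apply: hs.
by apply/forces_all => s; apply/forces_imp; apply: h.
Qed.

Lemma forces_ex p (phi : name P -> formula (name P)) s :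
  forces p (phi s) -> forces p (fEx phi).
Proof.
by move=> h; apply: dense_below_point => q qp; exists s; apply: forces_mono qp _.
Qed.

Lemma forces_eq_refl p s : forces_eq p s s.
Proof.
elim: s p => I s IH c p /=.
by split=> i; apply: dense_below_point => q qp qi; exists i.
Qed.


Lemma dense_below_sub D D' p : D `<=` D' -> dense_below D p -> dense_below D' p.
Proof. by move=> DD Dp r rp; have [q [qr /DD]] := Dp r rp; exists q. Qed.

Lemma forces_eq_sym p s t : forces_eq p s t -> forces_eq p t s.
Proof.
elim: s t p => I s IH c [J t d] p /= [h1 h2]; split=> i.
  by apply: dense_below_sub (h2 i) => q h /h [j [qj /IH ts]]; exists j; split.
by apply: dense_below_sub (h1 i) => q h /h [j [qj /IH ts]]; exists j; split.
Qed.

Lemma forces_eq_trans p s t u :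
  forces_eq p s t -> forces_eq p t u -> forces_eq p s u.
Proof.
elim: s t u p => I s IH c [J t d] [K u e] p /= [h1 h2] [k1 k2]; split=> i.
- move=> r rp; have [q [qr qi]] := h1 i r rp.
  (* The set to be met is an implication with premise [fle q (c i)], so a q that is not below [c i]
     belongs to it vacuously. *)
  have [/qi [j [qj sj]]|nqi] := pselect (fle q (c i)); last by exists q; split=> // /nqi.
  have [q' [q'q q'j]] := k1 j q (fle_trans qr rp).
  exists q'; split; first exact: fle_trans qr.
  move=> q'i; have [k [q'k tk]] := q'j (fle_trans q'q qj).
  by exists k; split=> //; apply: IH tk; apply: forces_eq_mono q'q _.
- move=> r rp; have [q [qr qi]] := k2 i r rp.
  have [/qi [j [qj sj]]|nqi] := pselect (fle q (e i)); last by exists q; split=> // /nqi.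
  have [q' [q'q q'j]] := h2 j q (fle_trans qr rp).
  exists q'; split; first exact: fle_trans qr.
  move=> q'i; have [k [q'k tk]] := q'j (fle_trans q'q qj).
  by exists k; split=> //; apply: IH tk _; apply: forces_eq_mono q'q _.
Qed.

Lemma forces_mem_eql p s t X :
  forces_eq p s t -> forces_mem p s X -> forces_mem p t X.
Proof.
case: X => I X c st; move/dense_below_bind; apply=> q qp [i [qi Xs]].
apply: dense_below_point => r rq; exists i; split; first exact: fle_trans qi.
apply: (@forces_eq_trans _ _ s); first exact: forces_eq_mono rq _.
by apply: forces_eq_mono st; apply: fle_trans qp.
Qed.

Lemma forces_mem_eqr p s X Y :
  forces_eq p X Y -> forces_mem p s X -> forces_mem p s Y.
Proof.
case: X => I X c; case: Y => J Y d [h _]; move/dense_below_bind; apply=> q qp [i [qi Xs]].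
move=> r rq; have [q' [q'r q'i]] := h i r (fle_trans rq qp).
have q'q := fle_trans q'r rq.
have [j [q'j XY]] := q'i (fle_trans q'q qi).
exists q'; split=> //; exists j; split=> //.
by apply: (forces_eq_trans (forces_eq_sym XY)); apply: forces_eq_mono q'q _.
Qed.

(** * Unordered and ordered pairs in the forcing language *)

Lemma forces_upair p z x y :
  forces p (fUPair z x y) <->
  forall w q, fle q p -> forces_mem q w z <->
    dense_below [set r | forces_eq r w x \/ forces_eq r w y] q.
Proof.
split=> [/forces_all h w q qp|h].
  move/forces_iff/(_ q qp): (h w) => [h1 h2].
  by split=> [/h1/forces_or //|hw]; apply: h2; apply/forces_or.
apply/forces_all => w; apply/forces_iff => q qp; have [h1 h2] := h w q qp.
by split=> [/h1 hw|/forces_or hw]; [apply/forces_or | apply: h2].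
Qed.

Lemma forces_upair_meml p z x y : forces p (fUPair z x y) -> forces p (fMem x z).
Proof.
move/forces_upair/(_ x p (fle_refl p)) => [_]; apply.
by apply: dense_below_point => q _; left; exact: forces_eq_refl.
Qed.

Lemma forces_upair_memr p z x y : forces p (fUPair z x y) -> forces p (fMem y z).
Proof.
move/forces_upair/(_ y p (fle_refl p)) => [_]; apply.
by apply: dense_below_point => q _; right; exact: forces_eq_refl.
Qed.

Lemma forces_upair_mem p z x y w :
  forces p (fUPair z x y) -> forces p (fMem w z) ->
  dense_below [set r | forces r (fEq w x) \/ forces r (fEq w y)] p.
Proof. by move/forces_upair/(_ w p (fle_refl p)) => [h _] /h. Qed.

Lemma forces_singleton_mem p z x w :
  forces p (fUPair z x x) -> forces p (fMem w z) -> forces p (fEq w x).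
Proof.
by move=> zx /(forces_upair_mem zx)/forces_bind; apply=> q _ [].
Qed.

Lemma forces_upair_eq p z z' x x' y y' :
  forces p (fEq z z') -> forces p (fEq x x') -> forces p (fEq y y') ->
  forces p (fUPair z x y) -> forces p (fUPair z' x' y').
Proof.
move=> zz xx yy /forces_upair h; apply/forces_upair => w q qp.
have [h1 h2] := h w q qp.
have low s t r : fle r q -> forces p (fEq s t) -> forces_eq r s t.
  by move=> rq; apply: forces_eq_mono; apply: fle_trans qp.
split=> [/(forces_mem_eqr (forces_eq_sym (low _ _ _ (fle_refl q) zz)))/h1|hw].
  move/dense_below_bind; apply=> r rq wr; apply: dense_below_point => r' r'r.
  have r'q := fle_trans r'r rq.
  case: wr => wr; [left|right];
  by apply: (forces_eq_trans (forces_eq_mono r'r wr)); apply: low.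
apply: (forces_mem_eqr (low _ _ _ (fle_refl q) zz)); apply/h2.
apply: dense_below_bind hw _ => r rq wr; apply: dense_below_point => r' r'r.
have r'q := fle_trans r'r rq.
by case: wr => wr; [left|right];
  apply: (forces_eq_trans (forces_eq_mono r'r wr)); apply: forces_eq_sym; apply: low.
Qed.

Lemma forces_opair p z x y :
  forces p (fOPair z x y) <->
  dense_below [set q | exists u v, [/\ forces q (fUPair u x x),
    forces q (fUPair v x y) & forces q (fUPair z u v)]] p.
Proof.
split=> /dense_below_bind; apply=> q qp [u].
  move/dense_below_bind; apply=> r rq [v [h1 [h2 h3]]].
  apply: dense_below_point => r' r'r; exists u, v.
  split; [exact: (forces_mono (phi := fUPair u x x) r'r)
    | exact: (forces_mono (phi := fUPair v x y) r'r)
    | exact: (forces_mono (phi := fUPair z u v) r'r)].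
move=> [v [h1 h2 h3]]; apply: dense_below_point => r rq; exists u.
by apply: dense_below_point => r' r'r; exists v;
  split; [|split]; move: (fle_trans r'r rq) => r'q;
  [exact: forces_mono r'q h1 | exact: forces_mono r'q h2 | exact: forces_mono r'q h3].
Qed.

Lemma forces_opair_eq p z z' x x' y y' :
  forces p (fEq z z') -> forces p (fEq x x') -> forces p (fEq y y') ->
  forces p (fOPair z x y) -> forces p (fOPair z' x' y').
Proof.
move=> zz xx yy /forces_opair h; apply/forces_opair.
apply: dense_below_bind h _ => q qp [u [v [h1 h2 h3]]].
apply: dense_below_point => r rq; exists u, v.
have rp := fle_trans rq qp.
move: (forces_mono rp zz) (forces_mono rp xx) (forces_mono rp yy) => rz rx ry.
have re s : forces r (fEq s s) by exact: forces_eq_refl.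
split.
- by apply: (forces_upair_eq (re u) rx rx); apply: forces_mono rq _.
- by apply: (forces_upair_eq (re v) rx ry); apply: forces_mono rq _.
- by apply: (forces_upair_eq rz (re u) (re v)); apply: forces_mono rq _.
Qed.

Lemma forces_app_eq p f x x' y y' :
  forces p (fEq x x') -> forces p (fEq y y') ->
  forces p (fApp f x y) -> forces p (fApp f x' y').
Proof.
move=> xx yy /dense_below_bind; apply=> q qp [z [h1 h2]].
apply: dense_below_point => r rq; exists z; split; last exact: (forces_mono (phi := fMem z f) rq h2).
apply: (@forces_opair_eq _ z _ x _ y); first exact: forces_eq_refl.
- by apply: forces_mono xx; apply: fle_trans qp.
- by apply: forces_mono yy; apply: fle_trans qp.
- exact: (forces_mono (phi := fOPair z x y) rq h1).
Qed.

Local Ltac descend qp :=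
  repeat match goal with
  | H : forces ?p _ |- _ =>
      match type of qp with fle _ p => apply (forces_mono qp) in H end
  end.

(** This is the usual argument for Kuratowski pairs. A disjunction is decided only densely, so each
    case distinction passes to a stronger condition. *)
Lemma forces_opair_inj p z x y x' y' :
  forces p (fOPair z x y) -> forces p (fOPair z x' y') ->
  forces p (fAnd (fEq x x') (fEq y y')).
Proof.
move=> /forces_opair h H; apply: (forces_bind h) => q qp [u [v [ux vxy zuv]]].
descend qp; move/forces_opair: H => H.
apply: (forces_bind H) => r rq [u' [v' [ux' vxy' zuv']]].
descend rq; move: r ux vxy zuv ux' vxy' zuv' {p q h H qp rq} => p ux vxy zuv ux' vxy' zuv'.
have mx := forces_upair_meml ux.
have mx' := forces_upair_memr ux'.
have my := forces_upair_memr vxy.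
have mx'v' := forces_upair_meml vxy'.
have my' := forces_upair_memr vxy'.
have mv := forces_upair_memr zuv.
have mv' := forces_upair_memr zuv'.
have mu := forces_upair_meml zuv.
have xx : forces p (fEq x x').
  apply: (forces_bind (forces_upair_mem zuv' mu)) => q qp uu; descend qp.
  (* If u = u' = {x'}, then x lies in {x'}; if u = v', then x' lies in v' = u = {x}. *)
  case: uu => uu.
    by apply: (forces_singleton_mem ux'); apply: forces_mem_eqr mx.
  apply: forces_eq_sym; apply: (forces_singleton_mem ux).
  by apply: forces_mem_eqr mx'v'; exact: forces_eq_sym.
split=> //.
apply: (forces_bind (forces_upair_mem zuv' mv)) => q qp uu; descend qp.
(* If v = u' = {x'}, then y = x'. Moreover v' is u or v, so y' lies in {x} or in {x'}, and y' = x'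
   either way. *)
case: uu => uu.
  have yx' : forces q (fEq y x').
    by apply: (forces_singleton_mem ux'); apply: forces_mem_eqr my.
  apply: (forces_bind (forces_upair_mem zuv mv')) => r rq ww; descend rq.
  apply: (forces_eq_trans yx'); apply: forces_eq_sym.
  case: ww => ww.
    apply: forces_eq_trans xx; apply: (forces_singleton_mem ux).
    exact: forces_mem_eqr my'.
  apply: (forces_singleton_mem ux').
  by apply: forces_mem_eqr uu _; apply: forces_mem_eqr my'.
(* Now v = v', so y is x' or y'. If y = x' = x, then y' lies in v = {x, y}, whose elements both
   equal y. *)
have yv' : forces q (fMem y v') by apply: forces_mem_eqr my.
apply: (forces_bind (forces_upair_mem vxy' yv')) => r rq [] //; descend rq => yx'.
have yv : forces r (fMem y' v).
  by apply: forces_mem_eqr my'; apply: forces_eq_sym.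
apply: (forces_bind (forces_upair_mem vxy yv)) => r' r'r ww; descend r'r.
case: ww => ww; last exact: forces_eq_sym.
apply: (forces_eq_trans yx'); apply: forces_eq_sym; exact: forces_eq_trans xx.
Qed.

(** As in [check], every condition is attached to each element, in place of a largest condition. *)
Definition upair_name x y : name P :=
  Name (fun bp : bool * P => if bp.1 then x else y) snd.

Definition opair_name x y : name P :=
  upair_name (upair_name x x) (upair_name x y).

Lemma forces_upair_name p x y : forces p (fUPair (upair_name x y) x y).
Proof.
apply/forces_upair => w q qp; split=> /dense_below_bind; apply=> r rq.
  move=> [[b r'] /= [rr' h]]; apply: dense_below_point => r2 r2r.
  by case: b h => h; [left|right]; apply: forces_eq_sym; apply: forces_eq_mono r2r _.
move=> wxy; apply: dense_below_point => r2 r2r.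
case: wxy => wxy; [exists (true, r2)|exists (false, r2)];
  by split; [exact: fle_refl | apply: forces_eq_sym; apply: forces_eq_mono r2r _].
Qed.

Lemma forces_opair_name p x y : forces p (fOPair (opair_name x y) x y).
Proof.
apply/forces_opair; apply: dense_below_point => q qp.
by exists (upair_name x x), (upair_name x y); split; apply: forces_upair_name.
Qed.

Lemma forces_mem_check p (T : Type) (h : T -> vset) i :
  forces_mem p (check P (h i)) (check P (VSet h)).
Proof.
apply: dense_below_point => q qp; exists (i, q).
by split; [exact: fle_refl | exact: forces_eq_refl].
Qed.

Lemma forces_mem_checkE p s (T : Type) (h : T -> vset) :
  forces_mem p s (check P (VSet h)) ->
  dense_below [set q | exists i, forces_eq q s (check P (h i))] p.
Proof.
apply: dense_below_sub => q [[i r] [qr hs]].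
by exists i; apply: forces_eq_sym.
Qed.

End ForcingTheory.

(** * Absoluteness of equality between check names *)

Fixpoint vset_eq (a b : vset) : Prop :=
  let: VSet T f := a in
  let: VSet U g := b in
  (forall i, exists j, vset_eq (f i) (g j)) /\
  (forall j, exists i, vset_eq (f i) (g j)).

(** The index [(i, p)] attaches p itself to the i-th element, so the implication in [forces_eq]
    applies below p and yields a match in the ground model. Here [vset_eq] is extensional equality
    of well-founded trees. *)
Lemma forces_eq_check (P : forcing_notion) (p : P) a b :
  forces_eq p (check P a) (check P b) -> vset_eq a b.
Proof.
elim: a b p => I f IH [J g] p /= [h1 h2]; split=> i.
  have [q [qp /(_ qp) [[j r] [_ /IH]]]] := h1 (i, p) p (fle_refl p).
  by exists j.
have [q [qp /(_ qp) [[j r] [_ /IH]]]] := h2 (i, p) p (fle_refl p).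
by exists j.
Qed.

Lemma vord_unfold x : vord x = VSet (fun y : {y | lt1 y x} => vord (sval y)).
Proof.
rewrite {1}/vord Fix_eq // => z f g fg; congr VSet.
by apply: funext => y; exact: fg.
Qed.

(** Otherwise the smaller of the two ordinals would be extensionally equal to one of its own
    elements, which the induction hypothesis turns into a violation of irreflexivity. *)
Lemma vord_inj x y : vset_eq (vord x) (vord y) -> x = y.
Proof.
elim/(well_founded_ind lt1_wf): x y => x IH y.
have [xy|//|yx] := lt1_total x y.
  rewrite vord_unfold (vord_unfold y) => -[_ /(_ (exist _ x xy))] /= [[z zx]] /= /IH.
  by move=> /(_ zx) zE; case: (@lt1_irrefl x); rewrite -{1}zE.
rewrite (vord_unfold x) (vord_unfold y) => -[/(_ (exist _ y yx)) + _] /= => -[[z zy]] /= /IH.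
by move=> /(_ yx) zE; case: (@lt1_irrefl z); rewrite -{2}zE.
Qed.

(** Displays the numeral as the set of smaller numerals, in a form on which [vset_eq] computes. *)
Lemma vnatP n : exists (T : Type) (f : T -> vset), [/\ vnat n = VSet f,
  forall i, exists2 k, (k < n)%N & f i = vnat k &
  forall k, (k < n)%N -> exists i, f i = vnat k].
Proof.
elim: n => [|n [T [f [nE f1 f2]]]]; first by exists False; eexists; split=> //; case.
exists (option T), (fun o => if o is Some i then f i else vnat n); split.
- by rewrite [LHS]/= nE.
- case=> [i|]; last by exists n.
  by have [k kn ->] := f1 i; exists k => //; apply: ltnW.
- move=> k; rewrite ltnS leq_eqVlt => /orP[/eqP ->|/f2 [i iE]]; first by exists None.
  by exists (Some i).
Qed.

Lemma vnat_inj m n : vset_eq (vnat m) (vnat n) -> m = n.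
Proof.
elim/ltn_ind: m n => m IH n.
have [T [f [mE f1 f2]]] := vnatP m; have [U [g [nE g1 g2]]] := vnatP n.
rewrite mE nE => -[h1 h2].
case: (ltngtP m n) => // mn.
  have [j jE] := g2 m mn; have [i] := h2 j; have [k km ->] := f1 i; rewrite jE => /IH.
  by move=> /(_ km) kE; rewrite kE ltnn in km.
have [i iE] := f2 n mn; have [j] := h1 i; have [k km ->] := g1 j; rewrite iE => /IH.
by move=> /(_ mn) kE; rewrite kE ltnn in km.
Qed.

(** * Dedekind cuts in the forcing language *)

Section Reals.
Variable R : realType.
Implicit Types x y : R.
Local Open Scope ring_scope.

Lemma forces_mem_vreal (P : forcing_notion) (p : P) x (q : rat) :
  forces_mem p (check P (vnat (pickle q))) (check P (vreal x)) <-> ratr q < x.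
Proof.
pose cut (q : {q : rat | ratr q < x}) := vnat (pickle (sval q)).
split=> [qx|qx]; last exact: (@forces_mem_check P p _ cut (exist _ q qx)).
have [r [_ [i qi]]] := @forces_mem_checkE P p _ _ cut qx p (fle_refl p).
have qE := vnat_inj (@forces_eq_check P r (vnat (pickle q)) (vnat (pickle (sval i))) qi).
by rewrite (pcan_inj pickleK qE); exact: svalP i.
Qed.

(** A rational between two distinct reals lies in exactly one of the two cuts, and membership of a
    rational in a cut is absolute. *)
Lemma forces_cut_lt (P : forcing_notion) (p : P) x y :
  forces p (fCutLt (check P (vreal x)) (check P (vreal y))) <-> x < y.
Proof.
have rat_btw (a b : R) : a < b -> exists2 q : rat, a < ratr q & ratr q < b.
  by move/rat_in_itvoo => [q]; rewrite in_itv /= => /andP[]; exists q.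
split=> [[sub /(_ p (fle_refl p)) neq]|xy].
  have {}sub := proj1 (@forces_allIn P p _ (fun z => fMem z (check P (vreal y)))) sub.
  case: (ltgtP x y) => // [yx|xy]; last by case: neq; rewrite xy; apply: forces_eq_refl.
  have [q yq qx] := rat_btw _ _ yx.
  have := sub _ _ (fle_refl p) (proj2 (forces_mem_vreal p x q) qx).
  by move/forces_mem_vreal => /(lt_trans yq); rewrite ltxx.
split.
  apply: (proj2 (@forces_allIn P p _ (fun z => fMem z (check P (vreal y))))).
  move=> s q qp sx.
  pose cut (q : {q : rat | ratr q < x}) := vnat (pickle (sval q)).
  apply: (forces_bind (@forces_mem_checkE P q s _ cut sx)) => r rq [[n nx] sn].
  apply: (forces_mem_eql (forces_eq_sym sn)).
  apply: (proj2 (forces_mem_vreal r y n)).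
  exact: lt_trans xy.
move=> q qp qe; have [n xn ny] := rat_btw _ _ xy.
have := forces_mem_eqr
  (@forces_eq_sym P q (check P (vreal x)) (check P (vreal y)) qe)
  (proj2 (forces_mem_vreal q y n) ny).
by move/forces_mem_vreal => /(lt_trans xn); rewrite ltxx.
Qed.

End Reals.

(** * Names for collapses and isomorphisms *)

Section Collapse.
Variable P : forcing_notion.
Implicit Types (p q : P) (s t : name P).

Lemma forces_exIn p s X (phi : name P -> formula (name P)) :
  forces_mem p s X -> forces p (phi s) -> forces p (fExIn X phi).
Proof.
move=> sX ps; apply: (@forces_ex P p (fun s => fAnd (fMem s X) (phi s)) s).
by split.
Qed.

Lemma forces_mem_vord p s b :
  forces_mem p s (check P (vord b)) ->
  dense_below [set q | exists2 y, lt1 y b & forces q (fEq s (check P (vord y)))] p.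
Proof.
rewrite vord_unfold => /forces_mem_checkE; apply: dense_below_sub => q [[y yb] sy].
by exists y.
Qed.

Lemma forces_mem_vord_lt1 p y b :
  lt1 y b -> forces_mem p (check P (vord y)) (check P (vord b)).
Proof.
move=> yb; rewrite (vord_unfold b).
exact: (@forces_mem_check P p _ (fun z : {y | lt1 y b} => vord (sval z)) (exist _ y yb)).
Qed.

(** [F p y z] stands for: p decides that the function being named sends y to z. The hypotheses say
    that such decisions cohere and that below [p0] they describe a map from b onto omega_1. *)
Variables (p0 : P) (b : omega1) (F : P -> omega1 -> omega1 -> Prop).
Hypothesis F_mono : forall p q y z, fle q p -> F p y z -> F q y z.
Hypothesis F_fun : forall p y z z', F p y z -> F p y z' -> z = z'.
Hypothesis F_total : forall p y, fle p p0 -> lt1 y b ->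
  exists q z, fle q p /\ F q y z.
Hypothesis F_onto : forall p z, fle p p0 -> exists q y,
  [/\ fle q p, lt1 y b & F q y z].

Let index : Type := {i : P * omega1 * omega1 | lt1 i.1.2 b /\ F i.1.1 i.1.2 i.2}.

Let f : name P :=
  Name (fun i : index => opair_name (check P (vord (sval i).1.2))
                                    (check P (vord (sval i).2)))
       (fun i => (sval i).1.1).

Let forces_app p y z x x' : lt1 y b -> F p y z ->
  forces p (fEq (check P (vord y)) x) -> forces p (fEq (check P (vord z)) x') ->
  forces p (fApp f x x').
Proof.
move=> yb Fyz yx zx'.
apply: (forces_app_eq yx zx').
apply: (@forces_ex P p (fun z => fAnd (fOPair z _ _) (fMem z f))
  (opair_name (check P (vord y)) (check P (vord z)))).
split; first exact: forces_opair_name.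
apply: dense_below_point => q qp.
by exists (exist _ (p, y, z) (conj yb Fyz)); split=> //; exact: forces_eq_refl.
Qed.

Let forces_mem_f p s : forces_mem p s f ->
  dense_below [set q | exists y z, [/\ lt1 y b, F q y z &
    forces_eq q (opair_name (check P (vord y)) (check P (vord z))) s]] p.
Proof.
apply: dense_below_sub => q [[[[r y] z] /= [yb Fyz]] /= [qr yzs]].
by exists y, z; split=> //; apply: F_mono qr _.
Qed.

(** Any pair in f is densely equal to one listed in [index]. Injectivity of pairs and of [vord]
    identifies its first coordinate with y, and [F_fun] then gives the second. *)
Let app_forces p x x' y z : lt1 y b -> F p y z ->
  forces p (fEq x (check P (vord y))) -> forces p (fApp f x x') ->
  forces p (fEq x' (check P (vord z))).
Proof.
move=> yb Fyz xy /forces_bind; apply=> q qp [s [sxx' sf]].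
apply: (forces_bind (forces_mem_f sf)) => r rq [y' [z' [y'b Fyz' zs]]].
have h : forces r (fOPair s x x') by exact: forces_mono rq _.
have h' : forces r (fOPair s (check P (vord y')) (check P (vord z'))).
  apply: forces_opair_eq zs (forces_eq_refl _ _) (forces_eq_refl _ _) _.
  exact: forces_opair_name.
have [xy' xz'] := forces_opair_inj h h'.
have rp := fle_trans rq qp.
have yy' : y = y'.
  apply: vord_inj; apply: (@forces_eq_check P r).
  by apply: forces_eq_trans (forces_eq_sym (forces_eq_mono rp xy)) xy'.
by rewrite -yy' in Fyz'; rewrite (F_fun (F_mono rp Fyz) Fyz').
Qed.

Lemma forces_collapsed : forces p0 (fCollapsed (check P vomega1)).
Proof.
have memw p z : forces_mem p (check P (vord z)) (check P vomega1).
  exact: (@forces_mem_check P p _ vord z).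
apply: (@forces_exIn _ (check P (vord b))); first exact: memw.
apply: (@forces_ex P p0 (fun f => fAnd (fFun f (check P (vord b)) (check P vomega1))
  (fOnto f (check P (vord b)) (check P vomega1))) f).
split; [split|].
- apply/forces_allIn => s p pp0 /forces_mem_f/forces_bind; apply=> q qp [y [z [yb Fyz ys]]].
  apply: (@forces_exIn _ (check P (vord y))); first exact: forces_mem_vord_lt1.
  apply: (@forces_exIn _ (check P (vord z))); first exact: memw.
  apply: (forces_opair_eq ys (forces_eq_refl _ _) (forces_eq_refl _ _)).
  exact: forces_opair_name.
- apply/forces_allIn => x p pp0 /forces_mem_vord/forces_bind; apply=> q qp [y yb xy].
  apply: (@forces_bind _ [set r | exists z, F r y z]).
    move=> r rq; have [r' [z [r'r Fyz]]] := F_total (fle_trans rq (fle_trans qp pp0)) yb.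
    by exists r'; split=> //; exists z.
  move=> r rq [z Fyz].
  have {}xy : forces r (fEq x (check P (vord y))) by exact: forces_mono rq _.
  apply: (@forces_exIn _ (check P (vord z))); first exact: memw.
  split.
    by apply: (forces_app yb Fyz); [exact: forces_eq_sym | exact: forces_eq_refl].
  apply/forces_all => x'; apply/forces_imp => r' r'r.
  by apply: app_forces yb _ _; [exact: F_mono r'r _ | exact: forces_mono r'r _].
- apply/forces_allIn => x p pp0 /(@forces_mem_checkE P p x _ vord)/forces_bind; apply=> q qp [z xz].
  apply: (@forces_bind _ [set r | exists2 y, lt1 y b & F r y z]).
    move=> r rq; have [r' [y [r'r yb Fyz]]] := F_onto z (fle_trans rq (fle_trans qp pp0)).
    by exists r'; split=> //; exists y.
  move=> r rq [y yb Fyz].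
  apply: (@forces_exIn _ (check P (vord y))); first exact: forces_mem_vord_lt1.
  apply: (forces_app yb Fyz); first exact: forces_eq_refl.
  by apply: forces_eq_sym; apply: forces_eq_mono rq _.
Qed.

End Collapse.

(** * Deciding values of an isomorphism onto the reverse order *)

Section ReverseIsomorphism.
Variables (R : realType) (P : forcing_notion) (A : set R).
Local Open Scope ring_scope.

(** The condition [q0] fixes a name f for an isomorphism, and [E p x y] means that p, below [q0],
    forces f(x) = -y. Composing f with negation gives a decreasing map from A to A. *)
Lemma decide_reverse_isomorphism (p0 : P) :
  forces_isomorphic_to_reverse P A ->
  exists (q0 : P) (E : P -> R -> R -> Prop), [/\ fle q0 p0,
    forall p q x y, fle q p -> E p x y -> E q x y,
    forall p x, fle p q0 -> A x -> exists q y, [/\ fle q p, A y & E q x y] &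
    forall p x x' y y', E p x y -> E p x' y' -> x < x' -> y' < y].
Proof.
move=> /(_ p0) /(_ p0 (fle_refl p0)) [q0 [q0p0 [f]]].
move=> [[[_ f_total] _] f_lt].
set cA := check P (vreals A) in f_total f_lt.
set cB := check P _ in f_total f_lt.
have {}f_total : forces q0 (fAllIn cA (fun x => fExIn cB (fun y =>
  fAnd (fApp f x y) (fAll (fun y' => fImp (fApp f x y') (fEq y' y)))))) := f_total.
have {}f_lt : forces q0 (fAllIn cA (fun x => fAllIn cA (fun x' =>
  fAllIn cB (fun y => fAllIn cB (fun y' => fImp (fAnd (fApp f x y) (fApp f x' y'))
    (fIff (fCutLt x x') (fCutLt y y'))))))) := f_lt.
have memA p x : A x -> forces_mem p (check P (vreal x)) cA.
  move=> Ax.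
  exact: (@forces_mem_check P p _ (fun x : {x : R | A x} => vreal (sval x)) (exist _ x Ax)).
have memB p x : A x -> forces_mem p (check P (vreal (- x))) cB.
  move=> Ax; have ANx : [set - r | r in A] (- x) by exists x.
  exact: (@forces_mem_check P p _
    (fun x : {x : R | [set - r | r in A] x} => vreal (sval x)) (exist _ (- x) ANx)).
exists q0, (fun p x y => [/\ fle p q0, A x, A y &
  forces p (fApp f (check P (vreal x)) (check P (vreal (- y))))]).
split=> //.
- by move=> p q x y qp [pq0 Ax Ay pf]; split=> //; [exact: fle_trans pq0 | exact: forces_mono qp _].
- move=> p x pq0 Ax.
  have [q [qp [s [/(_ q (fle_refl q)) + [sapp _]]]]] :=
    proj1 (forces_allIn _ _ _) f_total _ p pq0 (memA p x Ax) p (fle_refl p).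
  move=> [r [rq [[[y By] r'] [_ ys]]]].
  have {}ys : forces_eq r (check P (vreal y)) s := ys.
  have [z Az zE] := By.
  exists r, z; split=> //; first exact: fle_trans qp.
  split=> //; first exact: fle_trans (fle_trans rq qp) pq0.
  rewrite zE; apply: (@forces_app_eq P r f _ _ s); first exact: forces_eq_refl.
    exact: forces_eq_sym.
  exact: (forces_mono (phi := fApp f (check P (vreal x)) s) rq).
- move=> p x x' y y' [pq0 Ax Ay pxy] [_ Ax' Ay' pxy'] xx'.
  have {}f_lt := forces_mono (phi := fAllIn _ _) pq0 f_lt.
  have inst X phi s : forces_mem p s X -> forces p (fAllIn X phi) -> forces p (phi s).
    by move=> sX /forces_allIn; apply; first exact: fle_refl.
  move: f_lt => /(inst _ _ _ (memA p x Ax))/(inst _ _ _ (memA p x' Ax')).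
  move=> /(inst _ _ _ (memB p y Ay))/(inst _ _ _ (memB p y' Ay')).
  move/forces_imp/(_ p (fle_refl p) (conj pxy pxy'))/forces_iff/(_ p (fle_refl p)).
  by move=> [+ _] => /(_ (proj2 (forces_cut_lt _ _ _) xx'))/forces_cut_lt; rewrite ltrN2.
Qed.

End ReverseIsomorphism.

(** * Combinatorics of omega_1 *)

Lemma countable_not_all (V : set omega1) : countable V -> exists x, ~ V x.
Proof.
move=> cV; apply: contrapT => nV; apply: uncountable_omega1.
suff -> : [set: omega1] = V by [].
by apply/seteqP; split=> // x _; apply: contrapT => nx; apply: nV; exists x.
Qed.

Lemma countable_setU (T : Type) (U V : set T) :
  countable U -> countable V -> countable (U `|` V).
Proof.
move=> cU cV.
have -> : U `|` V = \bigcup_(b in [set: bool]) (if b then U else V).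
  apply/seteqP; split=> x /=; first by case; [exists true | exists false].
  by case=> -[] _; [left|right].
by apply: bigcup_countable => // -[].
Qed.

Lemma countable_le1 x : countable [set y | lt1 y x \/ y = x].
Proof.
exact: countable_setU (countable_lt1 x) (countable1 x).
Qed.

Lemma countable_upper_bound (V : set omega1) :
  countable V -> exists b, forall x, V x -> lt1 x b.
Proof.
move=> cV; have [|b nb] := @countable_not_all (\bigcup_(x in V) [set y | lt1 y x \/ y = x]).
  by apply: bigcup_countable => // x _; exact: countable_le1.
exists b => x Vx; case: (lt1_total x b) => // [xb|bx]; case: nb; exists x => //=.
  by right.
by left.
Qed.

(** The sequence [e x] may also take values outside the initial segment of x, so an empty segment
    needs no exception. *)
Lemma enum_below :
  exists e : omega1 -> nat -> omega1, forall x y, lt1 y x -> exists n, e x n = y.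
Proof.
suff /choice[e eP] : forall x, exists e : nat -> omega1,
    forall y, lt1 y x -> exists n, e n = y by exists e.
move=> x; case/countable_injP: (countable_lt1 x) => f fi.
have /choice[e eP] : forall n, exists y, forall z, lt1 z x -> f z = n -> y = z.
  move=> n; have [[z [zx zn]]|nz] := pselect (exists z, lt1 z x /\ f z = n).
    by exists z => z' z'x z'n; apply: fi; rewrite ?inE // zn z'n.
  by exists x => z zx zn; case: nz; exists z.
by exists e => y yx; exists (f y); apply: eP.
Qed.

(** Transfinite recursion: at stage i the supports chosen earlier have a countable union, since i
    has countably many predecessors, and the next choice avoids that union. *)
Lemma avoiding_sequence (X Y : Type) (supp : X -> set Y) (Q : omega1 -> set X) :
  (forall x, countable (supp x)) ->
  (forall i U, countable U -> exists2 x, Q i x & forall z, supp x z -> ~ U z) ->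
  exists2 f : omega1 -> X, forall i, Q i (f i) &
    forall i j z, lt1 j i -> supp (f i) z -> ~ supp (f j) z.
Proof.
move=> csupp ex.
have /choice[g gP] : forall iU : omega1 * set Y, exists x, countable iU.2 ->
    Q iU.1 x /\ forall z, supp x z -> ~ iU.2 z.
  move=> [i U] /=; have [cU|nU] := pselect (countable U).
    by have [x Qx xU] := ex i U cU; exists x.
  (* The choice function must be total: for uncountable U any element of X serves, and the case of
     the empty set supplies one. *)
  by have [x _ _] := ex i set0 (countable0 Y); exists x.
pose f := Fix lt1_wf (fun _ => X) (fun i rec =>
  g (i, [set z | exists j (ji : lt1 j i), supp (rec j ji) z])).
have fE i : f i = g (i, \bigcup_(j in [set j | lt1 j i]) supp (f j)).
  rewrite /f Fix_eq => [|j h k hk].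
    congr g; congr pair; apply/seteqP; split=> z /=.
      by move=> [j [ji jz]]; exists j.
    by move=> [j ji jz]; exists j, ji.
  congr g; congr pair; apply/seteqP; split=> z [l [lj lz]];
    by exists l, lj; rewrite ?hk // -hk.
have fP i : Q i (f i) /\ forall z, supp (f i) z ->
    ~ (\bigcup_(j in [set j | lt1 j i]) supp (f j)) z.
  rewrite fE; apply: (gP (i, _)) => /=.
  by apply: bigcup_countable => [|j _]; [exact: countable_lt1 | exact: csupp].
exists f => [i|i j z ji iz jz]; first by case: (fP i).
by case: (fP i) => _ /(_ z iz); apply; exists j.
Qed.

(** With singletons as supports, avoiding the earlier choices means being different from them, and
    no countable set exhausts S. *)
Lemma uncountable_injection (X : Type) (S : set X) :
  ~ countable S -> exists2 f : omega1 -> X, injective f & forall i, S (f i).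
Proof.
move=> nS; have [||f fS fd] := @avoiding_sequence X X (fun x => [set x]) (fun=> S).
- by move=> x; exact: countable1.
- move=> i U cU; apply: contrapT => nx; apply: nS; apply: sub_countable cU.
  apply: subset_card_le => x Sx; apply: contrapT => nUx; apply: nx.
  by exists x => // z ->.
by exists f => // i j ij; case: (lt1_total i j) => // h; case: (fd _ _ (f i) h).
Qed.

Lemma countable_pigeonhole (T : countType) (d : omega1 -> T) :
  exists t, ~ countable [set i | d i = t].
Proof.
apply: contrapT => nt; apply: uncountable_omega1.
suff -> : [set: omega1] = \bigcup_(t in [set: T]) [set i | d i = t].
  apply: bigcup_countable => [|t _]; first exact: countableP.
  by apply: contrapT => ct; apply: nt; exists t.
by apply/seteqP; split=> // i _; exists (d i).
Qed.

(** Take b above a strictly increasing omega-sequence h and let [dec] invert h, with value 0 off its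
    range. *)
Lemma omega1_nat_surjection :
  exists (b : omega1) (dec : omega1 -> nat), forall n, exists2 y, lt1 y b & dec y = n.
Proof.
have [x0 _] := countable_not_all (countable0 omega1).
have /choice[s sP] : forall x, exists y, lt1 x y.
  by move=> x; have [b /(_ x erefl)] := countable_upper_bound (countable1 x); exists b.
pose h n := iter n s x0.
have h_lt m n : (m < n)%N -> lt1 (h m) (h n).
  elim: n => // n IH; rewrite ltnS leq_eqVlt => /orP[/eqP ->|/IH hmn]; first exact: sP.
  exact: lt1_trans hmn (sP _).
have hi : injective h.
  by move=> m n hmn; case: (ltngtP m n) => // /h_lt; rewrite hmn => /lt1_irrefl.
have [b bP] := @countable_upper_bound (range h) (sub_countable (card_image_le h setT) (countableP _)).
have /choice[dec decP] : forall y, exists n, forall m, h m = y -> n = m.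
  move=> y; have [[m my]|nm] := pselect (exists m, h m = y).
    by exists m => k ky; apply: hi; rewrite my.
  by exists 0%N => m my; case: nm; exists m.
exists b, dec => n; exists (h n); last exact: decP.
by apply: bP; exists n.
Qed.

(** * Collapsing omega_1 by a countable unbounded set *)

Section CountableUnbounded.
Variables (P : forcing_notion) (p0 : P) (S : P -> nat -> omega1 -> Prop).
Hypothesis S_mono : forall p q n i, fle q p -> S p n i -> S q n i.
Hypothesis S_fun : forall p n i j, S p n i -> S p n j -> i = j.
Hypothesis S_unbounded : forall p V, fle p p0 -> countable V ->
  exists q n i, [/\ fle q p, ~ V i & S q n i].

(** Read [S p n i] as: p decides that the n-th member of a countable set is i. That set is
    unbounded, so sending (n, k) to the k-th entry of the ground model enumeration [e i] of the
    predecessors of the n-th member i covers omega_1; pairs (n, k) are coded by ordinals below b. *)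
Lemma forces_collapsed_unbounded : forces p0 (fCollapsed (check P vomega1)).
Proof.
have [e eP] := enum_below.
have [b [dec decP]] := omega1_nat_surjection.
pose dec2 y : nat * nat := odflt (0, 0)%N (unpickle (dec y)).
have dec2P n k : exists2 y, lt1 y b & dec2 y = (n, k).
  have [y yb yE] := decP (pickle (n, k)).
  by exists y => //; rewrite /dec2 yE pickleK.
(* The second disjunct makes F total where S names no value. *)
pose F (p : P) y z := (exists2 i, S p (dec2 y).1 i & z = e i (dec2 y).2) \/
  ((forall q i, fle q p -> ~ S q (dec2 y).1 i) /\ z = b).
apply: (@forces_collapsed P p0 b F).
- move=> p q y z qp [[i Si zE]|[nS zE]]; [left|right].
    by exists i => //; apply: S_mono qp _.
  by split=> // r i rq; apply: nS; apply: fle_trans qp.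
- move=> p y z z' [[i Si ->]|[nS ->]] [[j Sj ->]|[nS' ->]] //.
  + by rewrite (S_fun Si Sj).
  + by case: (nS' p i (fle_refl p)).
  + by case: (nS p j (fle_refl p)).
- move=> p y pp0 yb.
  have [[q [i [qp Si]]]|nS] := pselect (exists q i, fle q p /\ S q (dec2 y).1 i).
    by exists q, (e i (dec2 y).2); split=> //; left; exists i.
  exists p, b; split; [exact: fle_refl | right; split=> // q i qp Si].
  by apply: nS; exists q, i.
(* Some member i of the set can be decided above z, and then z occurs in the enumeration [e i]. *)
- move=> p z pp0; have [q [n [i [qp niz Si]]]] := S_unbounded pp0 (countable_le1 z).
  have zi : lt1 z i.
    by case: (lt1_total z i) => // h; case: niz; [right | left].
  have [k kE] := eP i z zi; have [y yb yE] := dec2P n k.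
  by exists q, y; split=> //; left; exists i; rewrite yE.
Qed.

End CountableUnbounded.

(** * Colourings from Martin's axiom *)

HB.instance Definition _ := gen_eqMixin omega1.

Section Colouring.
Variables (R : realType) (r : omega1 -> R).
Hypothesis r_inj : injective r.
Hypothesis r_good : forall (n : nat) (a : omega1 -> 'I_n -> omega1),
  (forall alpha, increasing1 (a alpha)) ->
  exists alpha beta, lt1 alpha beta /\
    forall i : 'I_n, (r (a alpha i) <= r (a beta i))%R.

(** Goodness concerns increasing tuples, so each [s i] is sorted without repetitions. Uncountably
    many indices share the label, the length of the sorted list and the positions in it of the
    entries of [s i]; through these positions the comparison returns to the original sequences. *)
Lemma good_sequences (T : countType) (d : omega1 -> T) (s : omega1 -> seq omega1) x0 :
  exists i j, [/\ i <> j, d i = d j, size (s i) = size (s j) &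
    forall k, (k < size (s i))%N -> (r (nth x0 (s i) k) <= r (nth x0 (s j) k))%R].
Proof.
pose leb (x y : omega1) := `[< x = y \/ lt1 x y >].
have leb_trans : transitive leb.
  move=> y x z /asboolP[->//|xy] /asboolP[<-|yz]; apply/asboolP; right=> //.
  exact: lt1_trans yz.
have leb_total : total leb.
  by move=> x y; apply/orP; case: (lt1_total x y) => h; [left|left|right]; apply/asboolP;
    [right|left|right].
pose u i := sort leb (undup (s i)).
have u_uniq i : uniq (u i) by rewrite sort_uniq undup_uniq.
have mem_u i x : (x \in u i) = (x \in s i) by rewrite mem_sort mem_undup.
pose shape i := (d i, size (u i), [seq index x (u i) | x <- s i]).
have [[[t m] l] /uncountable_injection[h h_inj hP]] := countable_pigeonhole shape.
pose a i (k : 'I_m) := nth x0 (u (h i)) k.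
have size_u i : size (u (h i)) = m by case: (hP i).
have index_u i : [seq index x (u (h i)) | x <- s (h i)] = l by case: (hP i).
have size_s i : size (s (h i)) = size l by rewrite -(index_u i) size_map.
have [|i [j [ij aij]]] := @r_good m a.
  move=> i k k' kk'.
  have : leb (a i k) (a i k').
    by apply: sorted_ltn_nth; rewrite ?inE ?size_u //; exact: sort_sorted.
  move=> /asboolP[/eqP|//]; rewrite /a nth_uniq ?size_u // => /eqP kE.
  by rewrite kE ltnn in kk'.
exists (h i), (h j); split.
- by move=> /h_inj hE; rewrite hE in ij; case: (lt1_irrefl ij).
- by case: (hP i) => -> _ _; case: (hP j).
- by rewrite !size_s.
move=> k kl.
have nth_u n : (k < size (s (h n)))%N ->
    nth x0 (s (h n)) k = nth x0 (u (h n)) (nth 0%N l k).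
  by move=> kn; rewrite -(index_u n) (nth_map x0) // nth_index // mem_u mem_nth.
have lm : (nth 0%N l k < m)%N.
  by rewrite -(index_u i) (nth_map x0) // -(size_u i) index_mem mem_u mem_nth.
have kj : (k < size (s (h j)))%N by rewrite size_s -(size_s i).
by rewrite !nth_u //; exact: aij (Ordinal lm).
Qed.

Variables xi eta : omega1 -> omega1.
Hypotheses (xi_inj : injective xi) (eta_inj : injective eta).
Local Open Scope ring_scope.

Definition comparable_pairs i j :=
  (r (xi i) < r (xi j) /\ r (eta i) < r (eta j)) \/
  (r (xi j) < r (xi i) /\ r (eta j) < r (eta i)).

Let separated_rat : exists mid : R -> R -> rat, forall x y,
  (x < y -> x < ratr (mid x y) < y) /\ (y < x -> y < ratr (mid x y) < x).
Proof.
suff /choice[mid midP] : forall xy : R * R, exists q : rat,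
    (xy.1 < xy.2 -> xy.1 < ratr q < xy.2) /\ (xy.2 < xy.1 -> xy.2 < ratr q < xy.1).
  by exists (fun x y => mid (x, y)) => x y; apply: midP (x, y).
move=> [x y] /=; case: (ltgtP x y) => [|/[dup] + /ltW|->]; last by exists 0.
- by move/[dup] => /rat_in_itvoo[q]; rewrite in_itv /= => qP xy; exists q.
- by move=> /rat_in_itvoo[q]; rewrite in_itv /= => qP xy; exists q.
Qed.

(** The first clause makes a set of coloured indices a function; the second makes each colour class
    a strictly increasing map from the reals at [xi] to those at [eta]. *)
Let agree (x y : omega1 * nat) :=
  (x.1 = y.1 -> x.2 = y.2) /\ (x.2 = y.2 -> x.1 <> y.1 -> comparable_pairs x.1 y.1).

Let agree_sym x y : agree x y -> agree y x.
Proof.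
move=> [h1 h2]; split=> [/esym/h1//|/esym/h2 h yx].
by have [[]|[]] := h (nesym yx); [right|left].
Qed.

Definition partial_colouring (q : seq (omega1 * nat)) : Prop :=
  forall x y, x \in q -> y \in q -> agree x y.

Definition colouring_poset : forcing_notion.
Proof.
apply: (@ForcingNotion {q | partial_colouring q}
  (fun q q' => {subset sval q' <= sval q})).
- by move=> p x.
- by move=> p q s pq qs x /qs /pq.
- by constructor; exists [::] => x y.
Defined.

(* Among uncountably many conditions, pick two of the same shape that are related
   by goodness.  The shape contains rationals separating the reals attached to
   distinct positions, so overlapping domains cause no conflict and no
   Delta-system is needed. *)
Lemma ccc_colouring_poset : ccc colouring_poset.
Proof.
move=> S antiS; apply: contrapT => /uncountable_injection[h h_inj hS].
have [mid midP] := separated_rat.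
pose q i := sval (h i).
have qP i : partial_colouring (q i) := svalP (h i).
pose D a b := (`[< a = b >], (r (xi a) < r (xi b), mid (r (xi a)) (r (xi b))),
  (r (eta a) < r (eta b), mid (r (eta a)) (r (eta b)))).
pose shape i := ([seq x.2 | x <- q i], [seq [seq D x.1 y.1 | y <- q i] | x <- q i]).
(* Concatenation lets one appeal to goodness raise both coordinates of all pairs at once. *)
pose v i := [seq xi x.1 | x <- q i] ++ [seq eta x.1 | x <- q i].
have [w _] := countable_not_all (countable0 omega1).
pose w' := (w, 0%N).
have [i [j [ij [col sep] _ le_v]]] := good_sequences shape v w.
have sz : size (q i) = size (q j) by rewrite -(size_map snd) col size_map.
have nth_col k : (k < size (q i))%N -> (nth w' (q i) k).2 = (nth w' (q j) k).2.
  by move=> kn; rewrite -!(nth_map w' 0%N snd) -?sz // col.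
have nth_sep k l : (k < size (q i))%N -> (l < size (q i))%N ->
    D (nth w' (q i) k).1 (nth w' (q i) l).1 = D (nth w' (q j) k).1 (nth w' (q j) l).1.
  move=> kn ln; have := congr1 (fun s => nth (D w w) (nth [::] s k) l) sep.
  by rewrite !(nth_map w') -?sz.
have nth_le k : (k < size (q i))%N ->
    r (xi (nth w' (q i) k).1) <= r (xi (nth w' (q j) k).1) /\
    r (eta (nth w' (q i) k).1) <= r (eta (nth w' (q j) k).1).
  move=> kn; have kj : (k < size (q j))%N by rewrite -sz.
  split.
    have := le_v k; rewrite /v !nth_cat !size_cat !size_map -sz kn.
    by rewrite !(nth_map w') // => -> //; rewrite ltn_addr.
  have := le_v (size (q i) + k)%N; rewrite /v !nth_cat !size_cat !size_map -sz.
  have -> : (size (q i) + k < size (q i))%N = false by rewrite ltnNge leq_addr.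
  by rewrite addKn !(nth_map w') // ltn_add2l; apply.
(* One rational separates x from y and x' from y', hence also x from y'. Distinctness of x' and y'
   turns the failure of x' < y' into y' < x'. *)
have sepP (x y x' y' : R) : (x < y, mid x y) = (x' < y', mid x' y') ->
    x' != y' -> (x < y -> x < y') /\ (y < x -> y' < x).
  move=> [lt_eq mid_eq] x'y'; split=> xy.
    have x'y'lt : x' < y' by rewrite -lt_eq.
    have /andP[xm _] := (midP x y).1 xy; have /andP[_ my] := (midP x' y').1 x'y'lt.
    by apply: lt_trans xm _; rewrite mid_eq.
  have y'x' : y' < x' by rewrite lt_neqAle eq_sym x'y' leNgt -lt_eq lt_gtF.
  have /andP[_ mx] := (midP x y).2 xy; have /andP[ym _] := (midP x' y').2 y'x'.
  by apply: lt_trans ym _; rewrite -mid_eq.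
have cross x y : x \in q i -> y \in q j -> agree x y.
  move=> /(nthP w')[k kn xE] /(nthP w')[l ln yE]; rewrite -sz in ln.
  have [] := nth_sep k l kn ln; have [le_xi le_eta] := nth_le k kn.
  have := qP i _ _ (mem_nth w' kn) (mem_nth w' ln).
  have := nth_col k kn; have := nth_col l ln; rewrite xE yE.
  move: (nth w' (q i) l) (nth w' (q j) k) le_xi le_eta => y' x'.
  rewrite xE => le_xi le_eta y'y xx' [h1 h2] eq_D sep_xi1 sep_xi2 sep_eta1 sep_eta2.
  (* Here y' is the entry of [q i] at the position of y, and x' the entry of [q j] at that of x. If
     x and y' have the same index, so do x' and y, and goodness compares x with y directly.
     Otherwise x and y' are already related within [q i], and [sepP] transfers their order to x and
     y. *)
  have [xy'|xy'] := pselect (x.1 = y'.1).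
    have x'y : x'.1 = y.1 by apply/asboolP; rewrite -eq_D; apply/asboolP.
    split=> [_|_ xy]; first by rewrite h1.
    have neq (phi : omega1 -> omega1) : injective phi -> r (phi x.1) != r (phi y.1).
      by move=> phi_inj; apply/eqP => /r_inj/phi_inj.
    by left; rewrite !lt_neqAle !neq //= -x'y.
  have x'y : x'.1 <> y.1.
    by move=> x'y; apply: xy'; apply/asboolP; rewrite eq_D; apply/asboolP.
  have neq (phi : omega1 -> omega1) a b : injective phi -> a <> b -> r (phi a) != r (phi b).
    by move=> phi_inj ab; apply/eqP => /r_inj/phi_inj.
  have [xi1 xi2] := sepP _ _ _ _ (congr2 pair sep_xi1 sep_xi2) (neq _ _ _ xi_inj x'y).
  have [eta1 eta2] := sepP _ _ _ _ (congr2 pair sep_eta1 sep_eta2) (neq _ _ _ eta_inj x'y).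
  split=> [xy|].
    have := neq _ _ _ xi_inj xy'.
    by rewrite neq_lt => /orP[/xi1|/xi2]; rewrite xy ltxx.
  rewrite -y'y => /h2/(_ xy') [[/xi1 ? /eta1 ?]|[/xi2 ? /eta2 ?]] _; first by left.
  by right.
have ij_col : partial_colouring (q i ++ q j).
  move=> x y; rewrite !mem_cat => /orP[xi'|xj] /orP[yi|yj].
  - exact: qP xi' yi.
  - exact: cross.
  - by apply: agree_sym; apply: cross.
  - exact: qP xj yj.
apply: (antiS (h i) (h j)) => //; first by move=> /h_inj.
by exists (exist _ _ ij_col); split=> x /= xq; rewrite mem_cat xq ?orbT.
Qed.

(** The conditions that colour a given index are dense. In a filter meeting all these sets, any two
    colour assignments lie in a common condition and therefore agree. *)
Lemma MA_colouring : MA_aleph1 ->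
  exists c : omega1 -> nat, forall i j, i <> j -> c i = c j -> comparable_pairs i j.
Proof.
move=> /(_ _ ccc_colouring_poset).
move=> /(_ (fun i => [set q : colouring_poset | exists n, (i, n) \in sval q])).
case=> [i [q qP]|G [[_ _ G_dir] GD]].
  have [[n iq]|niq] := pselect (exists n, (i, n) \in q).
    by exists (exist _ q qP); split=> //; exists n.
  (* A colour exceeding all those in use imposes no comparability requirement on the new index. *)
  pose n := (\max_(x <- q) x.2).+1.
  have nn x : x \in q -> x.2 <> n.
    move=> xq xn; have : (x.2 <= \max_(y <- q) y.2)%N by exact: leq_bigmax_seq.
    by rewrite xn ltnn.
  have ni x : x \in q -> x.1 <> i.
    by move=> xq xE; apply: niq; exists x.2; rewrite -xE -surjective_pairing.
  have qiP : partial_colouring ((i, n) :: q).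
    move=> x y; rewrite !inE => /orP[/eqP ->|xq] /orP[/eqP ->|yq].
    - by split.
    - by split=> /= [/esym/(ni _ yq)|/esym/(nn _ yq)].
    - by split=> /= [/(ni _ xq)|/(nn _ xq)].
    - exact: qP.
  exists (exist _ _ qiP); split; last by exists n; rewrite inE eqxx.
  by move=> x xq; rewrite inE xq orbT.
have /choice[c cP] : forall i, exists n, exists2 q, G q & (i, n) \in sval q.
  by move=> i; have [q [Gq [n iq]]] := GD i; exists n, q.
exists c => i j ij cij; have [q Gq iq] := cP i; have [q' Gq' jq'] := cP j.
have [s [_ sq sq']] := G_dir _ _ Gq Gq'.
by have [_] := svalP s _ _ (sq _ iq) (sq' _ jq'); apply.
Qed.

End Colouring.

Lemma card_aleph1_surjection (T : Type) :
  card_aleph1 [set: T] -> exists pi : omega1 -> T, forall t, exists i, pi i = t.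
Proof.
move=> /card_bijP[f [g fK _]].
have inT (U : Type) (u : U) : u \in [set: U] by rewrite inE.
exists (fun i => val (g (SigSub (inT _ i)))) => t.
exists (val (f (SigSub (inT _ t)))).
set x := SigSub _; suff -> : x = f (SigSub (inT _ t)) by rewrite fK.
exact: val_inj.
Qed.

(** * Small forcing notions *)

Section NoSmallForcing.
Variables (P : forcing_notion) (R : realType) (r : omega1 -> R).
Hypothesis r_inj : injective r.
Hypothesis no_collapse : forall p : P, ~ forces p (fCollapsed (check P vomega1)).
Local Open Scope ring_scope.

Variables (q0 : P) (E : P -> omega1 -> omega1 -> Prop).
Hypothesis E_mono : forall p q x y, fle q p -> E p x y -> E q x y.
Hypothesis E_total : forall p x, fle p q0 -> exists q y, fle q p /\ E q x y.
Hypothesis E_decr : forall p x x' y y',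
  E p x y -> E p x' y' -> r x < r x' -> r y' < r y.

(* Otherwise p forces a one-to-one map from the complement of U into the
   countable set U. *)
Lemma decided_pair_avoiding p U : fle p q0 -> countable U ->
  exists q x y, [/\ fle q p, E q x y, ~ U x & ~ U y].
Proof.
move=> pq0 cU; apply: contrapT => nU; apply: (no_collapse (p := p)).
have /countable_injP[code code_inj] := cU.
(* The point x is labelled by the code of its image in U. A decreasing map is one-to-one, so the
   label determines x. *)
pose S q n x := ~ U x /\ exists y, [/\ U y, code y = n & E q x y].
apply: (@forces_collapsed_unbounded P p S).
- by move=> s q n x qs [nUx [y [Uy yn Exy]]]; split=> //; exists y; split=> //; apply: E_mono qs _.
- move=> q n x x' [_ [y [Uy <- Exy]]] [_ [y' [Uy' y'n Exy']]].
  have yy' : y' = y by apply: code_inj; rewrite ?inE.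
  rewrite {}yy' {y' Uy' y'n} in Exy'.
  by apply: r_inj; case: (ltgtP (r x) (r x')) => // h;
    [have := E_decr Exy Exy' h|have := E_decr Exy' Exy h]; rewrite ltxx.
- move=> q V qp cV; have [x] := countable_not_all (countable_setU cU cV).
  move=> /not_orP[nUx nVx].
  have [s [y [sq Exy]]] := E_total x (fle_trans qp pq0).
  exists s, (code y), x; split=> //; split=> //; exists y; split=> //.
  by apply: contrapT => nUy; apply: nU; exists s, x, y; split=> //; apply: fle_trans qp.
Qed.

Lemma no_decreasing_name (pi : omega1 -> P) :
  (forall p, exists i, pi i = p) ->
  (forall xi eta : omega1 -> omega1, injective xi -> injective eta ->
    exists c : omega1 -> nat, forall i j, i <> j -> c i = c j ->
      comparable_pairs r xi eta i j) ->
  False.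
Proof.
move=> pi_surj colour; have [e eP] := enum_below.
pose supp (t : nat -> omega1 * omega1) :=
  \bigcup_(n in [set: nat]) ([set (t n).1] `|` [set (t n).2]).
(* At stage i the n-th pair serves the condition [pi (e i n)], so the stage serves every condition
   below [q0] that has an index under i. *)
pose Q i (t : nat -> omega1 * omega1) := forall n, fle (pi (e i n)) q0 ->
  exists2 q, fle q (pi (e i n)) & E q (t n).1 (t n).2.
have [t|i U cU|t tQ t_disj] := @avoiding_sequence _ _ supp Q.
- apply: bigcup_countable => // n _.
  by apply: countable_setU; exact: countable1.
- have /choice[t tP] : forall n, exists xy : omega1 * omega1,
      [/\ ~ U xy.1, ~ U xy.2 & fle (pi (e i n)) q0 ->
        exists2 q, fle q (pi (e i n)) & E q xy.1 xy.2].
    move=> n; have [pq|npq] := pselect (fle (pi (e i n)) q0).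
      have [q [x [y [qp Exy nx ny]]]] := decided_pair_avoiding pq cU.
      by exists (x, y); split=> // _; exists q.
    (* For a condition not below [q0] any pair avoiding U will do; it keeps the supports
       disjoint. *)
    have [q [x [y [qp Exy nx ny]]]] := decided_pair_avoiding (fle_refl q0) cU.
    by exists (x, y); split=> // /npq.
  exists t; first by move=> n; case: (tP n).
  by move=> z [n _ [->|->]]; case: (tP n).
have t_inj n : injective (fun i => (t i n).1) /\ injective (fun i => (t i n).2).
  have disj i j z : supp (t i) z -> supp (t j) z -> i = j.
    by move=> iz jz; case: (lt1_total i j) => // h; case: (t_disj _ _ z h).
  split=> i j /= ij.
    by apply: (disj _ _ (t i n).1); exists n => //; left; rewrite /= ?ij.
  by apply: (disj _ _ (t i n).2); exists n => //; right; rewrite /= ?ij.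
have /choice[c cP] : forall n, exists c : omega1 -> nat, forall i j,
    i <> j -> c i = c j ->
    comparable_pairs r (fun i => (t i n).1) (fun i => (t i n).2) i j.
  by move=> n; have [xi_inj eta_inj] := t_inj n; apply: colour.
(* The label k codes a sequence n and a colour. That colour class is increasing while the named map
   is decreasing, so p decides at most one i with label k. *)
pose S p k i := exists n, k = pickle (n, c n i) /\ E p (t i n).1 (t i n).2.
apply: (no_collapse (p := q0)); apply: (@forces_collapsed_unbounded P q0 S).
- by move=> p q k i qp [n [-> Et]]; exists n; split=> //; apply: E_mono qp _.
- move=> p k i j [n [-> Ei]] [n' [/(pcan_inj pickleK) [nn' cij] Ej]].
  rewrite -{n'}nn' in cij Ej; apply: contrapT => ij.
  by case: (cP n i j ij cij) => -[lt_xi lt_eta]; [have := E_decr Ei Ej lt_xi|have := E_decr Ej Ei lt_xi];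
    rewrite lt_gtF.
(* Any stage i above an index v of p serves p, and i can be chosen outside the countable set V. *)
- move=> p V pq0 cV; have [v vp] := pi_surj p.
  have [i /not_orP[niV niv]] := countable_not_all (countable_setU cV (countable_le1 v)).
  have vi : lt1 v i by case: (lt1_total v i) => // h; case: niv; [right|left].
  have [n nv] := eP i v vi.
  have := tQ i n; rewrite nv vp => /(_ pq0) [q qp Et].
  by exists q, (pickle (n, c n i)), i; split=> //; exists n.
Qed.

End NoSmallForcing.

Theorem theorem2 (R : realType) (A : set R) :
  MA_aleph1 -> good A -> aleph1_dense A ->
  ~ exists P : forcing_notion,
      [/\ card_aleph1 [set: P],
          not_collapse_aleph1 P &
          forces_isomorphic_to_reverse P A].
Proof.
move=> MA [r [r_inj r_range r_good]] _ [P [cardP no_col iso]].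
have [p0] := cond_inhabited P.
have [q0 [E [_ E_mono E_total E_decr]]] := decide_reverse_isomorphism p0 iso.
have [pi pi_surj] := card_aleph1_surjection cardP.
have rA i : A (r i) by rewrite -r_range; exists i.
apply: (@no_decreasing_name P R r r_inj _ q0 (fun p x y => E p (r x) (r y)) _ _ _ pi).
- by move=> p col; apply: (no_col p p (fle_refl p)).
- by move=> p q x y; apply: E_mono.
- move=> p x pq0; have [q [y [qp Ay Exy]]] := E_total p (r x) pq0 (rA x).
  by move: Ay; rewrite -r_range => -[z _ zE]; exists q, z; rewrite zE.
- by move=> p x x' y y'; apply: E_decr.
- exact: pi_surj.
- by move=> xi eta xi_inj eta_inj; apply: MA_colouring.
Qed.
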